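(* Let $D_+,D_-$ be periodic diagonal-norm first-derivative upwind SBP operators and $D$ a periodic first-derivative SBP operator, all with the same diagonal mass matrix $M$. Consider a globally stiffly accurate ImEx Runge-Kutta (ImEx-RK) method of type II, applied with fixed time step $\Delta t>0$ to the splitting $$\partial_t\mathbf q=f(\mathbf q)+g(\mathbf q),\qquad \mathbf q=\begin{pmatrix}\mathbf u\\\mathbf v\\\mathbf w\end{pmatrix},\quad f(\mathbf q)=\begin{pmatrix}-\tfrac13(D\mathbf u^2+\mathbf u\,D\mathbf u)\\\mathbf 0\\\mathbf 0\end{pmatrix},\quad g(\mathbf q)=\begin{pmatrix}-D_+\mathbf w\\ \tfrac1\tau(D\mathbf v-\mathbf w)\\ \tfrac1\tau(-D_-\mathbf u+\mathbf v)\end{pmatrix}$$ of the semidiscrete hyperbolic approximation (with relaxation parameter $\tau>0$) of the KdV equation, along with well-prepared initial data $$\mathbf v^0=D_-\mathbf u^0+\mathcal O(\tau),\qquad \mathbf w^0=DD_-\mathbf u^0+\mathcal O(\tau).$$ Then the method is asymptotic preserving (AP) for all the components $\mathbf u$, $\mathbf v$ and $\mathbf w$.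
   Context: SBP operators: all vectors are in $\mathbb R^N$, and nonlinear operations are pointwise: $\mathbf u^2=(u_i^2)_i$, $\mathbf u\,D\mathbf u=(u_i(D\mathbf u)_i)_i$. A periodic first-derivative SBP operator consists of a grid, a consistent first-derivative matrix $D\in\mathbb R^{N\times N}$, and a symmetric positive-definite matrix $M$ with $MD+D^TM=0$. A periodic first-derivative upwind SBP operator consists of a grid, consistent first-derivative matrices $D_\pm$, and a symmetric positive-definite $M$ with $MD_++D_-^TM=0$ and $\tfrac12M(D_+-D_-)$ negative semidefinite. Diagonal-norm means $M$ is diagonal. Consistency includes $D\mathbf 1=D_\pm\mathbf 1=\mathbf 0$, where $\mathbf 1=(1,\dots,1)^T$. ImEx-RK method: given a strictly lower triangular explicit matrix $\tilde A=(\tilde a_{ij})\in\mathbb R^{s\times s}$, a lower triangular implicit matrix $A=(a_{ij})\in\mathbb R^{s\times s}$ and weights $\tilde{\mathbf b},\mathbf b\in\mathbb R^s$, the method computes from $\mathbf q^n$ $$\mathbf q^{(i)}=\mathbf q^n+\Delta t\Big(\sum_{j=1}^{i-1}\tilde a_{ij}f(\mathbf q^{(j)})+\sum_{j=1}^{i}a_{ij}g(\mathbf q^{(j)})\Big),\ i=1,\dots,s,\qquad \mathbf q^{n+1}=\mathbf q^n+\Delta t\Big(\sum_{j=1}^s\tilde b_jf(\mathbf q^{(j)})+\sum_{j=1}^s b_jg(\mathbf q^{(j)})\Big).$$ It is of type II if $a_{11}=0$ (so that $\mathbf q^{(1)}=\mathbf q^n$) and the submatrix $\hat A=(a_{ij})_{i,j=2}^s$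 is invertible (and lower triangular). It is globally stiffly accurate if $\tilde a_{si}=\tilde b_i$ and $a_{si}=b_i$ for $i=1,\dots,s$. AP property: let $\boldsymbol\eta^{n}$ be the numerical solution obtained with the same ImEx-RK method and the same $\Delta t$ for the semidiscrete KdV equation $\partial_t\boldsymbol\eta=f(\boldsymbol\eta)+g(\boldsymbol\eta)$ with $f(\boldsymbol\eta)=-\tfrac13(D\boldsymbol\eta^2+\boldsymbol\eta\,D\boldsymbol\eta)$ (explicit) and $g(\boldsymbol\eta)=-D_+DD_-\boldsymbol\eta$ (implicit). AP for the $\mathbf u$-component means $\mathbf u^{n+1}\to\boldsymbol\eta^{n+1}$ as $\tau\to0$ for every $n\ge0$ (with $\Delta t$ and the spatial operators fixed). AP for the components $\mathbf v$ and $\mathbf w$ means $\mathbf v^{n+1}\to D_-\boldsymbol\eta^{n+1}$ and $\mathbf w^{n+1}\to DD_-\boldsymbol\eta^{n+1}$ as $\tau\to0$. The initial datum $\mathbf u^0$ (possibly depending on $\tau$) has a finite limit as $\tau\to0$, and $\boldsymbol\eta^0=\lim_{\tau\to0}\mathbf u^0$. *)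

(* Defs.v *)
(* MathComp / MathComp-Analysis *)
From HB Require Import structures.
From mathcomp Require Import all_boot all_order all_algebra.
From mathcomp Require Import all_classical all_reals all_analysis.
Set Implicit Arguments.
Unset Strict Implicit.
Unset Printing Implicit Defensive.
Import Order.TTheory GRing.Theory Num.Theory.
Import numFieldNormedType.Exports.
Local Open Scope classical_set_scope.
Local Open Scope ring_scope.

Definition symmetric_mx (R : realType) (N : nat) (M : 'M[R]_N) : Prop :=
  M^T = M.

Definition quad_form (R : realType) (N : nat) (M : 'M[R]_N) (x : 'cV[R]_N) : R :=
  (x^T *m M *m x) 0 0.

Definition positive_definite (R : realType) (N : nat) (M : 'M[R]_N) : Prop :=
  forall x : 'cV[R]_N, x != 0 -> 0 < quad_form M x.

Definition negative_semidefinite (R : realType) (N : nat) (M : 'M[R]_N) : Prop :=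
  forall x : 'cV[R]_N, quad_form M x <= 0.

(* Higher orders of accuracy are asymptotic statements about families of grids;
   for one periodic matrix, consistency means exactness on constants. *)
Definition consistent_derivative (R : realType) (N : nat) (D : 'M[R]_N) : Prop :=
  D *m (const_mx 1 : 'cV[R]_N) = 0.

(* The nodes of a grid are not assumed distinct or ordered: multi-block and
   discontinuous-Galerkin grids repeat the interface nodes. *)
Record periodic_sbp (R : realType) (N : nat) := PeriodicSBP {
  sbp_grid : 'cV[R]_N;
  sbp_D : 'M[R]_N;
  sbp_mass : 'M[R]_N;
  sbp_consistent : consistent_derivative sbp_D;
  sbp_mass_sym : symmetric_mx sbp_mass;
  sbp_mass_posdef : positive_definite sbp_mass;
  sbp_by_parts : sbp_mass *m sbp_D + sbp_D^T *m sbp_mass = 0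
}.

Record periodic_upwind_sbp (R : realType) (N : nat) := PeriodicUpwindSBP {
  usbp_grid : 'cV[R]_N;
  usbp_Dp : 'M[R]_N;
  usbp_Dm : 'M[R]_N;
  usbp_mass : 'M[R]_N;
  usbp_consistent_p : consistent_derivative usbp_Dp;
  usbp_consistent_m : consistent_derivative usbp_Dm;
  usbp_mass_sym : symmetric_mx usbp_mass;
  usbp_mass_posdef : positive_definite usbp_mass;
  usbp_by_parts : usbp_mass *m usbp_Dp + usbp_Dm^T *m usbp_mass = 0;
  usbp_dissipative :
    negative_semidefinite (2%:R^-1 *: (usbp_mass *m (usbp_Dp - usbp_Dm)))
}.

(* Stages are numbered from 0, and there is at least one of them. *)
Record imex_tableau (R : realType) (r : nat) := ImexTableau {
  imex_At : 'M[R]_r.+1;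
  imex_A : 'M[R]_r.+1;
  imex_bt : 'I_r.+1 -> R;
  imex_b : 'I_r.+1 -> R;
  imex_At_strictly_lower : forall i j : 'I_r.+1, (i <= j)%N -> imex_At i j = 0;
  imex_A_lower : is_trig_mx imex_A
}.

Definition imex_type_II (R : realType) (r : nat) (T : imex_tableau R r) : Prop :=
  imex_A T ord0 ord0 = 0 /\ row' ord0 (col' ord0 (imex_A T)) \in unitmx.

Definition globally_stiffly_accurate (R : realType) (r : nat)
    (T : imex_tableau R r) : Prop :=
  forall i : 'I_r.+1,
    imex_At T ord_max i = imex_bt T i /\ imex_A T ord_max i = imex_b T i.

(* A relation, since the stages Q are given by implicit equations. *)
Definition imex_step (R : realType) (r : nat) (T : imex_tableau R r)
    (V : lmodType R) (dt : R) (f g : V -> V) (q q' : V) : Prop :=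
  exists Q : 'I_r.+1 -> V,
    (forall i : 'I_r.+1,
       Q i = q + dt *: (\sum_(j < r.+1 | (j < i)%N) imex_At T i j *: f (Q j)
                        + \sum_(j < r.+1 | (j <= i)%N) imex_A T i j *: g (Q j)))
    /\ q' = q + dt *: (\sum_(j < r.+1) imex_bt T j *: f (Q j)
                       + \sum_(j < r.+1) imex_b T j *: g (Q j)).

Definition imex_solution (R : realType) (r : nat) (T : imex_tableau R r)
    (V : lmodType R) (dt : R) (f g : V -> V) (q : nat -> V) : Prop :=
  forall n : nat, imex_step T dt f g (q n) (q n.+1).

Definition vsquare (R : realType) (N : nat) (u : 'cV[R]_N) : 'cV[R]_N :=
  \col_i (u i 0 ^+ 2).

Definition vmul (R : realType) (N : nat) (u v : 'cV[R]_N) : 'cV[R]_N :=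
  \col_i (u i 0 * v i 0).

Definition kdv_f (R : realType) (N : nat) (D : 'M[R]_N) (u : 'cV[R]_N) :
    'cV[R]_N :=
  - (3%:R^-1 *: (D *m vsquare u + vmul u (D *m u))).

Definition kdv_g (R : realType) (N : nat) (Dp D Dm : 'M[R]_N) (u : 'cV[R]_N) :
    'cV[R]_N :=
  - (Dp *m D *m Dm *m u).

Definition state (R : realType) (N : nat) : lmodType R :=
  ('cV[R]_N * 'cV[R]_N * 'cV[R]_N)%type.

Definition hyp_f (R : realType) (N : nat) (D : 'M[R]_N) (q : state R N) :
    state R N :=
  let: (u, _, _) := q in (kdv_f D u, 0, 0).

Definition hyp_g (R : realType) (N : nat) (Dp D Dm : 'M[R]_N) (tau : R)
    (q : state R N) : state R N :=
  let: (u, v, w) := q in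
  (- (Dp *m w), tau^-1 *: (D *m v - w), tau^-1 *: (- (Dm *m u) + v)).

(* z tau n is a component of the numerical solution at step n for the
   relaxation parameter tau, and zeta n its prescribed limit. *)
Definition asymptotic_preserving (R : realType) (N : nat)
    (z : R -> nat -> 'cV[R]_N) (zeta : nat -> 'cV[R]_N) : Prop :=
  forall n : nat, z tau n.+1 @[tau --> 0^'+] --> zeta n.+1.

(* Main.v *)
(* By global stiff accuracy the new step is the last stage, so it suffices to
   follow the stages.  At a stage with diagonal coefficient a <> 0, the unknowns
   (u, v, w) solve a linear system (L + tau P) x = y(tau), where L is the system
   of the constraints v = D_- u, w = D v and of the implicit KdV stage equation.
   L is invertible because D_+ D D_- is skew-adjoint for M, so x(tau) tends to
   the KdV stage as soon as y(tau) does.  Only the limits of the initial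
   residuals v - D_- u and w - D D_- u matter, hence the argument propagates from
   stage to stage and from step to step. *)
Require Import Defs.
From HB Require Import structures.
From mathcomp Require Import all_boot all_order all_algebra.
From mathcomp Require Import all_classical all_reals all_analysis.
From mathcomp Require Import lra.
Import Order.TTheory GRing.Theory Num.Theory.
Import numFieldNormedType.Exports.
Local Open Scope classical_set_scope.
Local Open Scope ring_scope.

(** * Limits of matrices and of the nonlinear term *)

Lemma cvg_at_right_id {R : realType} (x : R) : t @[t --> x^'+] --> x.
Proof. exact: (cvg_at_right_filter (f := id) (cvg_id (F := nbhs x))). Qed.

(** A neighbourhood of a matrix contains a product of entrywise neighbourhoods, and finitely many
    conditions can be met at once along a filter. *)
Lemma cvg_mx (R : realType) (m n : nat) (I : Type) (F : set_system I)
    {FF : Filter F} (X : I -> 'M[R]_(m, n)) (X0 : 'M[R]_(m, n)) :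
  (forall i j, X t i j @[t --> F] --> X0 i j) -> X t @[t --> F] --> X0.
Proof.
move=> cX A [P nP sPA] /=; rewrite nbhs_simpl /=.
have : \forall t \near F, forall i j, P i j (X t i j).
  apply: filter_forall => i; apply: filter_forall => j.
  exact: cX (nP i j).
by apply: filterS => t Pt; apply: sPA.
Qed.

Lemma cvg_mx_coord {R : realType} {m n : nat} {I : Type} {F : set_system I}
    {FF : Filter F} {X : I -> 'M[R]_(m, n)} {X0 : 'M[R]_(m, n)} i j :
  X t @[t --> F] --> X0 -> X t i j @[t --> F] --> X0 i j.
Proof.
move=> cX; apply: (cvg_comp _ (fun M : 'M[R]_(m, n) => M i j) cX).
exact: coord_continuous.
Qed.

Lemma cvg_mulmx {R : realType} {m n p : nat} {I : Type} {F : set_system I}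
    {FF : Filter F} (B : 'M[R]_(m, n)) (X : I -> 'M[R]_(n, p)) X0 :
  X t @[t --> F] --> X0 -> B *m X t @[t --> F] --> B *m X0.
Proof.
move=> cX; apply: cvg_mx => i j.
rewrite mxE; under eq_cvg do rewrite mxE.
apply: cvg_big; first exact: add_continuous.
by move=> k _; apply: cvgMl_tmp; exact: cvg_mx_coord.
Qed.

Lemma cvg_vmul (R : realType) (N : nat) (I : Type) (F : set_system I)
    {FF : Filter F} (x y : I -> 'cV[R]_N) x0 y0 :
  x t @[t --> F] --> x0 -> y t @[t --> F] --> y0 ->
  vmul (x t) (y t) @[t --> F] --> vmul x0 y0.
Proof.
move=> cx cy; apply: cvg_mx => i j; rewrite mxE; under eq_cvg do rewrite mxE.
by apply: cvgM; exact: cvg_mx_coord.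
Qed.

Lemma cvg_kdv_f (R : realType) (N : nat) (I : Type) (F : set_system I)
    {FF : Filter F} (D : 'M[R]_N) (x : I -> 'cV[R]_N) x0 :
  x t @[t --> F] --> x0 -> kdv_f D (x t) @[t --> F] --> kdv_f D x0.
Proof.
have vsquareE (y : 'cV[R]_N) : vsquare y = vmul y y.
  by apply/matrixP => i j; rewrite !mxE expr2.
move=> cx; rewrite /kdv_f; apply: cvgN; apply: cvgZl_tmp; apply: cvgD.
  rewrite vsquareE; under eq_cvg do rewrite vsquareE.
  by apply: cvg_mulmx; exact: cvg_vmul.
by apply: cvg_vmul => //; exact: cvg_mulmx.
Qed.

Lemma cvg_col_mx (R : realType) (m1 m2 n : nat) (I : Type) (F : set_system I)
    {FF : Filter F} (X : I -> 'M[R]_(m1, n)) (Y : I -> 'M[R]_(m2, n))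
    (X0 : 'M[R]_(m1, n)) (Y0 : 'M[R]_(m2, n)) :
  X t @[t --> F] --> X0 -> Y t @[t --> F] --> Y0 ->
  col_mx (X t) (Y t) @[t --> F] --> col_mx X0 Y0.
Proof.
move=> cX cY; apply: cvg_mx => i j; case: (split_ordP i) => k ->.
  by rewrite col_mxEu; under eq_cvg do rewrite col_mxEu; exact: cvg_mx_coord.
by rewrite col_mxEd; under eq_cvg do rewrite col_mxEd; exact: cvg_mx_coord.
Qed.

Lemma cvg_col_mx_inv (R : realType) (m1 m2 n : nat) (I : Type) (F : set_system I)
    {FF : Filter F} (X : I -> 'M[R]_(m1, n)) (Y : I -> 'M[R]_(m2, n))
    (X0 : 'M[R]_(m1, n)) (Y0 : 'M[R]_(m2, n)) :
  col_mx (X t) (Y t) @[t --> F] --> col_mx X0 Y0 ->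
  X t @[t --> F] --> X0 /\ Y t @[t --> F] --> Y0.
Proof.
move=> cXY; split; apply: cvg_mx => i j.
  have := cvg_mx_coord (lshift m2 i) j cXY.
  rewrite col_mxEu; under eq_cvg do rewrite col_mxEu.
  by apply.
have := cvg_mx_coord (rshift m1 i) j cXY.
rewrite col_mxEd; under eq_cvg do rewrite col_mxEd.
by apply.
Qed.

(** * Linear systems with a vanishing perturbation *)

(** The equation itself bounds [x]: since [B] is bounded, for small [t] the perturbation is absorbed
    into the left-hand side, so it is O(t) and vanishes in the limit. *)
Lemma cvg_perturbed_fixpoint (R : realType) (n : nat) (B : 'M[R]_n)
    (x z : R -> 'cV[R]_n) (x0 : 'cV[R]_n) :
  (forall t, 0 < t -> x t = z t - t *: (B *m x t)) ->
  z t @[t --> 0^'+] --> x0 -> x t @[t --> 0^'+] --> x0.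
Proof.
move=> xE cz.
have cB : continuous (mulmx B : 'cV[R]_n -> 'cV[R]_n).
  by move=> y; apply: (cvg_mulmx (F := nbhs y) B id y); exact: cvg_id.
have [C C0 Bx] : exists2 C, 0 < C & forall y : 'cV[R]_n, `|B *m y| <= C * `|y|.
  by have /linear_bounded_continuous/linear_boundedP/pinfty_ex_gt0[C C0 BC]
    := cB; exists C.
(* For 2 C t <= 1 the term t *: (B *m x t) is at most half of x t, so |x t| is
   at most 2 |z t|. *)
have c0 : t *: (B *m x t) @[t --> 0^'+] --> (0 : 'cV[R]_n).
  apply: norm_cvg0.
  apply: (@squeeze_cvgr _ _ _ _ (cst 0) (fun t => t * (C * (2 * `|z t|)))).
  - near=> t.
    have t0 : 0 < t by near: t; exact: nbhs_right_gt.
    have tC : t <= (2 * C)^-1.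
      by near: t; apply: nbhs_right_le; rewrite invr_gt0 mulr_gt0.
    rewrite normr_ge0 /= normrZ gtr0_norm // ler_wpM2l ?(ltW t0) //.
    rewrite (le_trans (Bx _)) // ler_pM2l //.
    have tB : `|t *: (B *m x t)| <= 2^-1 * `|x t|.
      rewrite normrZ gtr0_norm // (le_trans (ler_wpM2l (ltW t0) (Bx _))) //.
      rewrite mulrA ler_wpM2r // (le_trans (ler_wpM2r (ltW C0) tC)) //.
      by rewrite invfM -mulrA mulVf ?mulr1 // gt_eqF.
    have := ler_normB (z t) (t *: (B *m x t)); rewrite -xE //.
    lra.
  - exact: cvg_cst.
  - rewrite -[X in _ --> X](mul0r (C * (2 * `|x0|))).
    apply: cvgM; first exact: cvg_at_right_id.
    by do 2!apply: cvgMl_tmp; exact: cvg_norm.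
rewrite -[x0]subr0.
apply: (cvg_trans _ (cvgB cz c0)); apply: near_eq_cvg.
by near=> t; apply/esym/xE; near: t; exact: nbhs_right_gt.
Unshelve. all: by end_near. Qed.

Lemma injective_unitmx (F : fieldType) (n : nat) (A : 'M[F]_n) :
  (forall x : 'cV_n, A *m x = 0 -> x = 0) -> A \in unitmx.
Proof.
(* [kermx] is a kernel of row vectors, hence the passage to the transpose. *)
move=> injA; rewrite -unitmx_tr -row_free_unit -kermx_eq0.
apply/eqP/row_matrixP => i; rewrite row0 -[row i _]trmxK.
rewrite [X in X^T]injA ?trmx0 //.
by apply: trmx_inj; rewrite trmx_mul trmxK trmx0 -row_mul mulmx_ker row0.
Qed.

(** Multiplying by the inverse of [L] gives the fixed-point form with [B = invmx L *m P]; the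
    solutions [x t] are given, so only [L] has to be inverted. *)
Lemma cvg_perturbed_linear (R : realType) (n : nat) (L P : 'M[R]_n)
    (x y : R -> 'cV[R]_n) (x0 : 'cV[R]_n) :
  L \in unitmx ->
  (forall t, 0 < t -> (L + t *: P) *m x t = y t) ->
  y t @[t --> 0^'+] --> L *m x0 -> x t @[t --> 0^'+] --> x0.
Proof.
move=> uL xE cy.
apply: (@cvg_perturbed_fixpoint _ _ (invmx L *m P) x (fun t => invmx L *m y t)).
  move=> t t0; rewrite -xE // mulmxDl mulmxDr mulKmx // -scalemxAl -scalemxAr.
  by rewrite mulmxA addrK.
by rewrite -[x0](mulKmx uL); exact: cvg_mulmx.
Qed.

(** * Solvability of the implicit KdV stage by summation by parts *)

Section UpwindOperators.
Context {R : realType} {N : nat}.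
Variables (M Dp D Dm : 'M[R]_N).
Hypotheses (Msym : symmetric_mx M) (Mpos : positive_definite M).
Hypotheses (upwind : M *m Dp + Dm^T *m M = 0) (skew : M *m D + D^T *m M = 0).

(** A scalar equals its transpose, while transposing changes the sign of [M *m D]; the value is
    therefore its own opposite. *)
Lemma quad_form_skew (x : 'cV[R]_N) : quad_form (M *m D) x = 0.
Proof.
have MDT : (M *m D)^T = - (M *m D).
  by apply/eqP; rewrite trmx_mul Msym -addr_eq0 addrC skew.
have : quad_form (M *m D) x = - quad_form (M *m D) x.
  rewrite {1}/quad_form -[x^T *m _ *m x]trmxK mxE trmx_mul.
  rewrite (trmx_mul _ (M *m D)) trmxK MDT.
  by rewrite mulNmx mulmxN mxE mulmxA.
by move=> /eqP; rewrite -addr_eq0 -mulr2n mulrn_eq0 => /eqP.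
Qed.

(* [Dp *m D *m Dm] is skew-adjoint for M, so the sign of [a] plays no role. *)
Lemma unitmx_dispersion (a : R) : 1%:M + a *: (Dp *m D *m Dm) \in unitmx.
Proof.
apply: injective_unitmx => x; rewrite mulmxDl mul1mx => /eqP.
rewrite addr_eq0 => /eqP xE.
have MDp : M *m Dp = - (Dm^T *m M) by apply/eqP; rewrite -addr_eq0 upwind.
(* The upwind relation moves [Dp] to the other side as [Dm^T], so the energy of a kernel vector [x]
   is [a] times the form of [M *m D] at [Dm *m x], which is zero. *)
have Mx : M *m x = a *: (Dm^T *m (M *m D) *m (Dm *m x)).
  rewrite {1}xE -scalemxAl mulmxN -scalemxAr !mulmxA MDp.
  by rewrite !mulNmx scalerN opprK.
have Qx : quad_form M x = 0.
  rewrite /quad_form -mulmxA Mx -scalemxAr mxE.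
  have -> : x^T *m (Dm^T *m (M *m D) *m (Dm *m x))
      = (Dm *m x)^T *m (M *m D) *m (Dm *m x) by rewrite trmx_mul !mulmxA.
  by have := quad_form_skew (Dm *m x); rewrite /quad_form => ->; rewrite mulr0.
apply/eqP; apply/negPn/negP => /Mpos; rewrite Qx.
by rewrite ltxx.
Qed.

End UpwindOperators.

(** * The relaxation limit of a single stage *)

Lemma relaxation_stage_cvg (R : realType) (N : nat) (Dp D Dm : 'M[R]_N)
    (a : R) (u v w A B C : R -> 'cV[R]_N) (eta : 'cV[R]_N) :
  a != 0 -> 1%:M + a *: (Dp *m D *m Dm) \in unitmx ->
  (forall t, 0 < t -> [/\ u t + a *: (Dp *m w t) = A t,
     t *: v t - a *: (D *m v t - w t) = B t &
     t *: w t - a *: (v t - Dm *m u t) = C t]) ->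
  A t @[t --> 0^'+] --> eta + a *: (Dp *m (D *m Dm *m eta)) ->
  B t @[t --> 0^'+] --> (0 : 'cV[R]_N) ->
  C t @[t --> 0^'+] --> (0 : 'cV[R]_N) ->
  [/\ u t @[t --> 0^'+] --> eta, v t @[t --> 0^'+] --> Dm *m eta
    & w t @[t --> 0^'+] --> D *m Dm *m eta].
Proof.
rewrite -(mulmxA D Dm) => a0 uK stage cA cB cC.
(* [L] collects the stage equations at [t = 0]; [P] is the identity on the [v] and [w] blocks, the
   only ones that carry a factor [t]. *)
pose L : 'M[R]_(N + (N + N)) :=
  block_mx 1%:M (row_mx 0 (a *: Dp))
    (col_mx 0 (a *: Dm)) (block_mx (- (a *: D)) a%:M (- a%:M) 0).
pose P : 'M[R]_(N + (N + N)) := block_mx 0 0 0 1%:M.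
have LE x y z : L *m col_mx x (col_mx y z) = col_mx (x + a *: (Dp *m z))
    (col_mx (- (a *: (D *m y - z))) (- (a *: (y - Dm *m x)))).
  rewrite mul_block_col mul1mx mul_row_col mul0mx add0r -scalemxAl.
  rewrite mul_col_mx mul_block_col !mul0mx -scalemxAl mulNmx -scalemxAl.
  rewrite mulNmx !mul_scalar_mx addr0 add_col_mx add0r.
  by rewrite !scalerBr !opprB [- (a *: (D *m y)) + _]addrC.
have PE x y z : P *m col_mx x (col_mx y z) = col_mx 0 (col_mx y z).
  by rewrite mul_block_col !mul0mx !mul1mx !add0r.
have uL : L \in unitmx.
  apply: injective_unitmx => x.
  rewrite -[x]vsubmxK -[dsubmx x]vsubmxK; set x1 := usubmx x.
  set x2 := usubmx _; set x3 := dsubmx _.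
  rewrite LE -[0]vsubmxK -[dsubmx 0]vsubmxK !linear0 => /eq_col_mx[e1].
  move=> /eq_col_mx[/eqP e2 /eqP e3].
  move: e2; rewrite oppr_eq0 scaler_eq0 (negPf a0) subr_eq0 /= => /eqP e2.
  move: e3; rewrite oppr_eq0 scaler_eq0 (negPf a0) subr_eq0 /= => /eqP e3.
  (* In the kernel of [L] the constraints [x2 = Dm *m x1] and [x3 = D *m x2] hold because [a != 0].
     Substituting them into the first row leaves the KdV stage matrix applied to [x1]. *)
  have x10 : x1 = 0.
    rewrite -[x1](mulKmx uK) mulmxDl mul1mx -scalemxAl -!mulmxA -e3 e2.
    by rewrite e1 mulmx0.
  by rewrite -e2 e3 x10 !mulmx0 !col_mx0.
have : col_mx (u t) (col_mx (v t) (w t)) @[t --> 0^'+] -->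
    col_mx eta (col_mx (Dm *m eta) (D *m (Dm *m eta))).
  apply: (@cvg_perturbed_linear _ _ L P _
    (fun t => col_mx (A t) (col_mx (B t) (C t)))) => //.
    move=> t t0; have [<- <- <-] := stage t t0.
    rewrite mulmxDl LE -scalemxAl PE !scale_col_mx scaler0 !add_col_mx addr0.
    by rewrite [t *: v t - _]addrC [t *: w t - _]addrC.
  rewrite LE !subrr !scaler0 oppr0.
  by apply: cvg_col_mx => //; exact: cvg_col_mx.
by move=> /cvg_col_mx_inv[cu /cvg_col_mx_inv[cv cw]].
Qed.

(** * Consequences of type II and global stiff accuracy *)

Section Tableau.
Context {R : realType} {r : nat}.
Context {T : imex_tableau R r}.

(** The determinant of the triangular submatrix is the product of its diagonal entries, so
    invertibility makes each of them nonzero. *)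
Lemma imex_A_diag_neq0 (i : 'I_r.+1) :
  imex_type_II T -> i != ord0 -> imex_A T i i != 0.
Proof.
move=> [_ uA]; case: (unliftP ord0 i) => [j ->|->]; last by rewrite eqxx.
move=> _; move: uA; rewrite unitmxE unitfE det_trig.
  by move/prodf_neq0 => /(_ j isT); rewrite !mxE.
apply/is_trig_mxP => k l kl; rewrite !mxE.
have /is_trig_mxP := imex_A_lower T; apply.
by rewrite !lift0 ltnS.
Qed.

Context {V : lmodType R} {dt : R} {f g : V -> V}.

Lemma imex_step_stages {q q' : V} :
  globally_stiffly_accurate T -> imex_step T dt f g q q' ->
  exists2 Q : 'I_r.+1 -> V, q' = Q ord_max &
    forall i : 'I_r.+1, Q i =
      (q + dt *: (\sum_(j < r.+1 | (j < i)%N) imex_At T i j *: f (Q j)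
                + \sum_(j < r.+1 | (j < i)%N) imex_A T i j *: g (Q j)))
      + (dt * imex_A T i i) *: g (Q i).
Proof.
move=> GSA [Q [QE q'E]]; exists Q.
  rewrite q'E QE; congr (_ + dt *: (_ + _)).
    (* The explicit weights sum over all stages, the last stage only over earlier ones; the extra
       term is the last one, with coefficient zero by strict triangularity. *)
    rewrite [RHS]big_mkcond; apply: eq_bigr => j _; rewrite -(proj1 (GSA j)).
    by case: ltnP => // le; rewrite imex_At_strictly_lower ?scale0r.
  rewrite [RHS]big_mkcond; apply: eq_bigr => j _; rewrite -(proj2 (GSA j)).
  by rewrite -ltnS ltn_ord.
(* The diagonal term is split off, leaving only earlier stages in both sums. *)
move=> i; rewrite {1}QE (bigD1 (P := fun j : 'I_ _ => (j <= i)%N) i) //=.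
rewrite -[_ + _ + (_ * _) *: _]addrA -scalerA -scalerDr -addrA.
rewrite [_ + \sum_(_ < _ | _) _ in LHS]addrC.
congr (_ + dt *: (_ + (_ + _))); apply: eq_bigl => j.
by rewrite ltn_neqAle andbC.
Qed.

End Tableau.

(** * Relaxed stage equations cleared of the factor 1/tau *)

Section RelaxedStages.
Context {R : realType} {N r : nat}.
Variables (Dp D Dm : 'M[R]_N) (T : imex_tableau R r) (dt : R).
Implicit Types (u v w : 'cV[R]_N) (i : 'I_r.+1) (U V W : 'I_r.+1 -> 'cV[R]_N).

Definition stage_rhs_u u U W i : 'cV[R]_N := u + dt *:
  (\sum_(j < r.+1 | (j < i)%N) imex_At T i j *: kdv_f D (U j)
   - \sum_(j < r.+1 | (j < i)%N) imex_A T i j *: (Dp *m W j)).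

(** The [v] and [w] equations are multiplied by [tau], so that their right-hand sides make sense at
    [tau = 0], where the limits are evaluated. *)
Definition stage_rhs_v tau v V W i : 'cV[R]_N := tau *: v + dt *:
  \sum_(j < r.+1 | (j < i)%N) imex_A T i j *: (D *m V j - W j).

Definition stage_rhs_w tau w U V i : 'cV[R]_N := tau *: w + dt *:
  \sum_(j < r.+1 | (j < i)%N) imex_A T i j *: (V j - Dm *m U j).

Lemma hyp_fE (q : state R N) : hyp_f D q = (kdv_f D q.1.1, 0, 0).
Proof. by case: q => -[]. Qed.

Lemma hyp_gE tau (q : state R N) : hyp_g Dp D Dm tau q = (- (Dp *m q.2),
  tau^-1 *: (D *m q.1.2 - q.2), tau^-1 *: (q.1.2 - Dm *m q.1.1)).
Proof. by case: q => -[x y z]; rewrite [y - _]addrC. Qed.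

(** Serves both [v] and [w]: their explicit part is zero and their implicit part carries 1/tau,
    which multiplication by [tau] cancels. *)
Lemma relaxation_stageE (tau a : R) i (y y0 x : 'cV[R]_N)
    (X : 'I_r.+1 -> 'cV[R]_N) :
  0 < tau ->
  y = y0 + dt *: (\sum_(j < r.+1 | (j < i)%N) imex_At T i j *: 0
      + \sum_(j < r.+1 | (j < i)%N) imex_A T i j *: (tau^-1 *: X j))
    + a *: (tau^-1 *: x) ->
  tau *: y - a *: x =
    tau *: y0 + dt *: \sum_(j < r.+1 | (j < i)%N) imex_A T i j *: X j.
Proof.
move=> t0 ->; rewrite big1 ?add0r => [|j _]; last by rewrite scaler0.
under eq_bigr do rewrite scalerA mulrC -scalerA.
rewrite -scaler_sumr !scalerDr !scalerA [tau * (dt / tau)]mulrC.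
by rewrite divfK ?gt_eqF // [tau * a]mulrC mulfK ?gt_eqF // addrK.
Qed.

Lemma relaxed_imex_step_stages tau u v w (q' : state R N) : 0 < tau ->
  globally_stiffly_accurate T ->
  imex_step T dt (hyp_f D) (hyp_g Dp D Dm tau) ((u, v, w) : state R N) q' ->
  exists U V W, q' = (U ord_max, V ord_max, W ord_max) /\ forall i,
    [/\ U i + (dt * imex_A T i i) *: (Dp *m W i) = stage_rhs_u u U W i,
        tau *: V i - (dt * imex_A T i i) *: (D *m V i - W i)
          = stage_rhs_v tau v V W i
      & tau *: W i - (dt * imex_A T i i) *: (V i - Dm *m U i)
          = stage_rhs_w tau w U V i].
Proof.
move=> t0 GSA /(imex_step_stages GSA)[Q -> QE].
exists (fun i => (Q i).1.1), (fun i => (Q i).1.2), (fun i => (Q i).2).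
split=> [|i]; first by case: (Q ord_max) => -[].
split.
- rewrite {1}QE hyp_gE /stage_rhs_u /= !raddf_sum /= scalerN subrK.
  congr (_ + dt *: (_ + _)); apply: eq_bigr => j _; first by rewrite hyp_fE.
  by rewrite hyp_gE /= scalerN.
- apply: relaxation_stageE => //; rewrite {1}QE hyp_gE /= !raddf_sum /=.
  by congr (_ + dt *: (_ + _) + _); apply: eq_bigr => j _;
    rewrite ?hyp_fE ?hyp_gE.
- apply: relaxation_stageE => //; rewrite {1}QE hyp_gE /= !raddf_sum /=.
  by congr (_ + dt *: (_ + _) + _); apply: eq_bigr => j _;
    rewrite ?hyp_fE ?hyp_gE.
Qed.

End RelaxedStages.

(** * Convergence of one step, then of the whole solution *)

Lemma imex_step_cvg {R : realType} {N r : nat} {Dp D Dm : 'M[R]_N}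
    {T : imex_tableau R r} {dt : R} {u v w u' v' w' : R -> 'cV[R]_N}
    {eta eta' : 'cV[R]_N} :
  (forall a : R, 1%:M + a *: (Dp *m D *m Dm) \in unitmx) ->
  imex_type_II T -> globally_stiffly_accurate T -> 0 < dt ->
  (forall tau, 0 < tau -> imex_step T dt (hyp_f D) (hyp_g Dp D Dm tau)
     ((u tau, v tau, w tau) : state R N) (u' tau, v' tau, w' tau)) ->
  imex_step T dt (kdv_f D) (kdv_g Dp D Dm) eta eta' ->
  [/\ u tau @[tau --> 0^'+] --> eta, v tau @[tau --> 0^'+] --> Dm *m eta
    & w tau @[tau --> 0^'+] --> D *m Dm *m eta] ->
  [/\ u' tau @[tau --> 0^'+] --> eta', v' tau @[tau --> 0^'+] --> Dm *m eta'
    & w' tau @[tau --> 0^'+] --> D *m Dm *m eta'].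
Proof.
move=> uK TII GSA dt0 hyp kdv [cu cv cw].
have [/= E -> EE] := imex_step_stages GSA kdv.
have exQ (tau : R) :
    exists Q : ('I_r.+1 -> 'cV[R]_N) * ('I_r.+1 -> 'cV[R]_N)
               * ('I_r.+1 -> 'cV[R]_N),
    0 < tau -> (u' tau, v' tau, w' tau) =
        (Q.1.1 ord_max, Q.1.2 ord_max, Q.2 ord_max) /\ forall i,
    [/\ Q.1.1 i + (dt * imex_A T i i) *: (Dp *m Q.2 i)
          = stage_rhs_u Dp D T dt (u tau) Q.1.1 Q.2 i,
        tau *: Q.1.2 i - (dt * imex_A T i i) *: (D *m Q.1.2 i - Q.2 i)
          = stage_rhs_v D T dt tau (v tau) Q.1.2 Q.2 i
      & tau *: Q.2 i - (dt * imex_A T i i) *: (Q.1.2 i - Dm *m Q.1.1 i)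
          = stage_rhs_w Dm T dt tau (w tau) Q.1.1 Q.1.2 i].
  (* Choosing stages as functions of [tau] requires values for every real [tau]; the zero stages at
     [tau <= 0] are invisible to a limit from the right. *)
  have [t0|] := ltP 0 tau; last by exists (fun=> 0, fun=> 0, fun=> 0).
  have [U [V [W QP]]] :=
    relaxed_imex_step_stages _ _ _ _ _ _ _ _ _ _ t0 GSA (hyp tau t0).
  by exists (U, V, W).
have [Q QP] := choice exQ.
pose U (i : 'I_r.+1) (tau : R) : 'cV[R]_N := (Q tau).1.1 i.
pose V (i : 'I_r.+1) (tau : R) : 'cV[R]_N := (Q tau).1.2 i.
pose W (i : 'I_r.+1) (tau : R) : 'cV[R]_N := (Q tau).2 i.
have c0 : tau @[tau --> (0 : R)^'+] --> (0 : R).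
  exact: cvg_at_right_id.
have cQ (i : 'I_r.+1) : [/\ U i tau @[tau --> 0^'+] --> (E i : 'cV[R]_N),
    V i tau @[tau --> 0^'+] --> Dm *m E i
  & W i tau @[tau --> 0^'+] --> D *m Dm *m E i].
  (* Strong induction, since a stage depends on all the earlier ones. *)
  have [n] := ubnP (val i); elim: n i => // n IH i /ltnSE lei.
  have {}IH (j : 'I_r.+1) (ji : (j < i)%N) := IH j (leq_trans ji lei).
  (* At the first stage the diagonal coefficient vanishes, so [L] is of no use; the stage is the
     initial state itself, after cancelling [tau] in the [v] and [w] equations. *)
  have [i0|in0] := eqVneq i ord0.
    have A0 : imex_A T i i = 0 by rewrite i0; case: TII.
    have sum0 (F : 'I_r.+1 -> 'cV[R]_N) : \sum_(j < r.+1 | (j < i)%N) F j = 0.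
      by rewrite big_pred0 // => j; rewrite i0.
    have -> : E i = eta.
      by rewrite EE A0 mulr0 scale0r !sum0 !addr0 scaler0 addr0.
    have init tau : 0 < tau ->
        [/\ u tau = U i tau, v tau = V i tau & w tau = W i tau].
      move=> t0; have [_ /(_ i)] := QP tau t0.
      rewrite A0 mulr0 !scale0r !subr0 addr0.
      rewrite /stage_rhs_u /stage_rhs_v /stage_rhs_w.
      rewrite !sum0 subr0 scaler0 !addr0 => -[eU eV eW].
      split; first exact/esym.
        by apply: (scalerI (lt0r_neq0 t0)); rewrite eV.
      by apply: (scalerI (lt0r_neq0 t0)); rewrite eW.
    split; [move: cu | move: cv | move: cw]; apply: cvg_trans;
      apply: near_eq_cvg; near=> tau;
      by have [] := init tau; first by near: tau; exact: nbhs_right_gt.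
  apply: (relaxation_stage_cvg _ _ Dp _ _ (dt * imex_A T i i) _ _ _
    (fun tau => stage_rhs_u Dp D T dt (u tau) (U^~ tau) (W^~ tau) i)
    (fun tau => stage_rhs_v D T dt tau (v tau) (V^~ tau) (W^~ tau) i)
    (fun tau => stage_rhs_w Dm T dt tau (w tau) (U^~ tau) (V^~ tau) i)).
  - by apply: mulf_neq0; [rewrite gt_eqF | exact: imex_A_diag_neq0].
  - exact: uK.
  - by move=> tau t0; exact: (proj2 (QP tau t0) i).
  (* This is the KdV stage equation, with [D *m Dm *m E j] in the place of [W j]. *)
  - have -> : E i + (dt * imex_A T i i) *: (Dp *m (D *m Dm *m E i))
        = stage_rhs_u Dp D T dt eta E (fun j => D *m Dm *m E j) i.
      rewrite {1}EE /kdv_g /stage_rhs_u scalerN !mulmxA subrK -sumrN.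
      by congr (_ + _ *: (_ + _)); apply: eq_bigr => j _;
        rewrite scalerN !mulmxA.
    apply: cvgD => //; apply: cvgZl_tmp; apply: cvgB.
      apply: cvg_big => [|j /IH[cU _ _]]; first exact: add_continuous.
      by apply: cvgZl_tmp; exact: cvg_kdv_f.
    apply: cvg_big => [|j /IH[_ _ cW]]; first exact: add_continuous.
    by apply: cvgZl_tmp; exact: cvg_mulmx.
  (* The limits of the earlier stages satisfy the constraints exactly, so every summand vanishes;
     the term [tau *: v] vanishes because [v] converges. *)
  - have -> : 0 = stage_rhs_v D T dt 0 (Dm *m eta) (fun j => Dm *m E j)
        (fun j => D *m Dm *m E j) i.
      rewrite /stage_rhs_v scale0r add0r big1 ?scaler0 // => j _.
      by rewrite mulmxA subrr scaler0.
    apply: cvgD; first exact: cvgZ.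
    apply: cvgZl_tmp; apply: cvg_big => [|j /IH[_ cV cW]].
      exact: add_continuous.
    by apply: cvgZl_tmp; apply: cvgB => //; exact: cvg_mulmx.
  - have -> : 0 = stage_rhs_w Dm T dt 0 (D *m Dm *m eta) E
        (fun j => Dm *m E j) i.
      rewrite /stage_rhs_w scale0r add0r big1 ?scaler0 // => j _.
      by rewrite subrr scaler0.
    apply: cvgD; first exact: cvgZ.
    apply: cvgZl_tmp; apply: cvg_big => [|j /IH[cU cV _]].
      exact: add_continuous.
    by apply: cvgZl_tmp; apply: cvgB => //; exact: cvg_mulmx.
have final tau : 0 < tau ->
    [/\ U ord_max tau = u' tau, V ord_max tau = v' tau
      & W ord_max tau = w' tau].
  by move=> t0; have [[-> -> ->]] := QP tau t0.
have [cU cV cW] := cQ ord_max.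
split; [move: cU | move: cV | move: cW]; apply: cvg_trans;
  apply: near_eq_cvg; near=> tau;
  by have [] := final tau; first by near: tau; exact: nbhs_right_gt.
Unshelve. all: by end_near. Qed.

Lemma cvg_of_bigO_id {R : realType} {n : nat} {x y : R -> 'cV[R]_n}
    {y0 : 'cV[R]_n} :
  (fun tau : R => x tau - y tau) =O_ (0^'+) (fun tau : R => tau) ->
  y tau @[tau --> 0^'+] --> y0 -> x tau @[tau --> 0^'+] --> y0.
Proof.
move=> /eqO_exP[k k0 xy] cy.
have c0 : x tau - y tau @[tau --> 0^'+] --> (0 : 'cV[R]_n).
  apply: norm_cvg0.
  apply: (@squeeze_cvgr _ _ _ _ (cst 0) (fun t : R => k * `|t|)).
  - by apply: filterS xy => t /= ->; rewrite normr_ge0.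
  - exact: cvg_cst.
  - rewrite -[X in _ --> X](mulr0 k) -[X in k * X](normr0 R).
    by apply: cvgMl_tmp; apply: cvg_norm; exact: cvg_at_right_id.
have -> : x = (fun t => x t - y t + y t) by apply/funext => t; rewrite subrK.
by rewrite -[y0]add0r; exact: cvgD.
Qed.

Theorem theorem6 (R : realType) (N r : nat)
    (U : periodic_upwind_sbp R N) (S : periodic_sbp R N)
    (Mdiag : is_diag_mx (usbp_mass U)) (sameM : sbp_mass S = usbp_mass U)
    (T : imex_tableau R r)
    (TII : imex_type_II T) (GSA : globally_stiffly_accurate T)
    (dt : R) (dt_gt0 : 0 < dt)
    (u v w : R -> nat -> 'cV[R]_N) (eta : nat -> 'cV[R]_N)
    (hyp_sol : forall tau : R, 0 < tau ->
       imex_solution T dt (hyp_f (sbp_D S))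
         (hyp_g (usbp_Dp U) (sbp_D S) (usbp_Dm U) tau)
         (fun n => (u tau n, v tau n, w tau n) : state R N))
    (well_prepared_v :
       (fun tau : R => v tau 0%N - usbp_Dm U *m u tau 0%N)
         =O_ (0^'+) (fun tau : R => tau))
    (well_prepared_w :
       (fun tau : R => w tau 0%N - sbp_D S *m usbp_Dm U *m u tau 0%N)
         =O_ (0^'+) (fun tau : R => tau))
    (eta0 : u tau 0%N @[tau --> 0^'+] --> eta 0%N)
    (kdv_sol : imex_solution T dt (kdv_f (sbp_D S))
         (kdv_g (usbp_Dp U) (sbp_D S) (usbp_Dm U)) eta) :
  [/\ asymptotic_preserving u eta,
      asymptotic_preserving v (fun n => usbp_Dm U *m eta n)
    & asymptotic_preserving w (fun n => sbp_D S *m usbp_Dm U *m eta n)].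
Proof.
have skew : usbp_mass U *m sbp_D S + (sbp_D S)^T *m usbp_mass U = 0.
  by rewrite -sameM; exact: sbp_by_parts.
have uK := unitmx_dispersion _ _ _ _ (usbp_mass_sym U) (usbp_mass_posdef U)
  (usbp_by_parts U) skew.
have cvg n : [/\ u tau n @[tau --> 0^'+] --> eta n,
    v tau n @[tau --> 0^'+] --> usbp_Dm U *m eta n
  & w tau n @[tau --> 0^'+] --> sbp_D S *m usbp_Dm U *m eta n].
  elim: n => [|n IH].
    (* The O(tau) bounds on the initial data enter here, and only through the limits they imply. *)
    split=> //; [apply: cvg_of_bigO_id well_prepared_v _
               | apply: cvg_of_bigO_id well_prepared_w _]; exact: cvg_mulmx.
  exact: (imex_step_cvg uK TII GSA dt_gt0 (fun tau t0 => hyp_sol tau t0 n)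
    (kdv_sol n) IH).
by split=> n; have [] := cvg n.+1.
Qed.
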